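(* Let $g \in L^2(\mathbb{R}^d)$ be an arbitrary real-valued window function. If $\mathcal{L} \subseteq \mathbb{R}^{2d}$ satisfies $\mathcal{L} \subseteq \Lambda \times \mathbb{R}^d$ for some lattice $\Lambda \subseteq \mathbb{R}^d$, then the set $$\mathcal{N}_{\mathbb{R}}(g,\mathcal{L}) = \{ f \in L^2(\mathbb{R}^d, \mathbb{R}) : \exists h \in L^2(\mathbb{R}^d, \mathbb{R}) \text{ with } h \nsim f \text{ and } |V_gf(z)| = |V_gh(z)|\ \forall z\in\mathcal{L} \}$$ contains an infinite-dimensional cone.
   Context: $V_gf(x,\omega)=\int_{\mathbb{R}^d} f(t)\overline{g(t-x)}e^{-2\pi i \omega\cdot t}\,dt$ is the short-time Fourier transform. $L^2(\mathbb{R}^d,\mathbb{R})$ denotes the real-valued functions in $L^2(\mathbb{R}^d)$. For functions $f,h$, $f\sim h$ means there is $\nu\in\mathbb{C}$, $|\nu|=1$, with $f=\nu h$; $f\nsim h$ means this fails. A lattice in $\mathbb{R}^d$ is $A\mathbb{Z}^d$ with $A\in\mathrm{GL}_d(\mathbb{R})$. A cone in a vector space $V$ is a set $C$ with $\kappa C\subseteq C$ for all $\kappa>0$; it is infinite-dimensional if not contained in any finite-dimensional subspace. *)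

(* Defs.v *)
From HB Require Import structures.
From mathcomp Require Import all_boot all_order all_algebra.
From mathcomp Require Import all_classical all_reals all_analysis.
From mathcomp.real_closed Require Import complex.
Set Implicit Arguments. Unset Strict Implicit. Unset Printing Implicit Defensive.
Import Order.TTheory GRing.Theory Num.Theory.
Import numFieldNormedType.Exports.
Local Open Scope classical_set_scope.
Local Open Scope ring_scope.

Section Defs.
Variable R : realType.

Definition borel_rV (d : nat) : set (set 'rV[R]_d) :=
  <<s [set U : set 'rV[R]_d | open U] >>.

Definition borel_fun (d : nat) (f : 'rV[R]_d -> R) : Prop :=
  forall B : set R, measurable B -> borel_rV (f @^-1` B).

Fixpoint iint (d : nat) : ('rV[R]_d -> \bar R) -> \bar R :=
  match d return ('rV[R]_d -> \bar R) -> \bar R with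
  | 0 => fun F => F 0
  | n.+1 => fun F =>
      (\int[@lebesgue_measure R]_x iint (fun v : 'rV[R]_n => F (row_mx (\row_(i < 1) x) v)))%E
  end.

Definition lebRd (d : nat) (A : set 'rV[R]_d) : \bar R := iint (fun t => (\1_A t)%:E).

Definition L2 (d : nat) (f : 'rV[R]_d -> R) : Prop :=
  borel_fun f /\ (iint (fun t => (f t ^+ 2)%:E) < +oo)%E.

Definition rint (d : nat) (F : 'rV[R]_d -> R) : R :=
  fine (iint (fun t => (F^\+ t)%:E)) - fine (iint (fun t => (F^\- t)%:E)).

Definition cint (d : nat) (F : 'rV[R]_d -> R[i]) : R[i] :=
  Complex (rint (fun t => complex.Re (F t))) (rint (fun t => complex.Im (F t))).

Definition dotp (d : nat) (u v : 'rV[R]_d) : R := \sum_(i < d) u 0 i * v 0 i.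

Definition expi (th : R) : R[i] := Complex (cos th) (sin th).

Definition RtoC (x : R) : R[i] := Complex x 0.

Definition STFT (d : nat) (g f : 'rV[R]_d -> R) (x w : 'rV[R]_d) : R[i] :=
  cint (fun t => RtoC (f t) * conjc (RtoC (g (t - x))) * expi (- (2 * pi * dotp w t))).

Definition ae_eqC (d : nat) (f h : 'rV[R]_d -> R[i]) : Prop :=
  lebRd [set t | f t != h t] = 0%E.

Definition sim (d : nat) (f h : 'rV[R]_d -> R) : Prop :=
  exists nu : R[i], `|nu| = 1 /\ ae_eqC (fun t => RtoC (f t)) (fun t => nu * RtoC (h t)).

Definition NR (d : nat) (g : 'rV[R]_d -> R) (L : set ('rV[R]_d * 'rV[R]_d))
  : set ('rV[R]_d -> R) :=
  [set f | L2 f /\ exists h : 'rV[R]_d -> R, L2 h /\ not (sim f h) /\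
     forall z, L z -> `|STFT g f z.1 z.2| = `|STFT g h z.1 z.2|].

Definition is_lattice (d : nat) (Lam : set 'rV[R]_d) : Prop :=
  exists A : 'M[R]_d, A \in unitmx /\
    Lam = [set x | exists k : 'rV[int]_d, x = map_mx intr k *m A].

Definition is_cone (d : nat) (C : set ('rV[R]_d -> R)) : Prop :=
  forall k : R, 0 < k -> forall c, C c -> C (fun t => k * c t).

(* C (viewed in L^2(R^d,R), i.e. modulo a.e. equality) is not contained in any
   finite-dimensional subspace, i.e. in the span of finitely many L^2 functions *)
Definition infinite_dim (d : nat) (C : set ('rV[R]_d -> R)) : Prop :=
  not (exists (n : nat) (e : 'I_n -> 'rV[R]_d -> R), (forall i, L2 (e i)) /\
      forall c, C c -> exists a : 'I_n -> R,
        lebRd [set t | c t != \sum_(i < n) a i * e i t] = 0%E).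

End Defs.

(* Main.v *)
(** Let [u] be the first coordinate in the basis of the lattice and [p] a bounded
    function of the fractional part of [u], hence periodic under the lattice.
    Put [f t = p t * g (- t)] and [h t = p (- t) * g (- t)].  For a lattice
    point [x] the product [h t * g (t - x)] is the reflection [t |-> x - t] of
    the real function [f t * g (t - x)], so the two Fourier transforms have the
    same modulus.  Taking [p] to be the powers of the fractional part gives
    an infinite-dimensional family: a nonzero polynomial, or the symmetry
    [p t ^ 2 = p (- t) ^ 2], confines [u] to countably many values, i.e. [t] to
    a null set of hyperplanes.  If [g] vanishes almost everywhere, all
    transforms are [0] and any other non-null [G] can replace [g (- t)].

    The iterated integral [iint] is identified, on nonnegative Borel functions,
    with the integral against a sigma-finite measure, by Tonelli's theorem and
    induction on the dimension. *)

Require Import Defs.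
From HB Require Import structures.
From mathcomp Require Import all_boot all_order all_algebra.
From mathcomp Require Import all_classical all_reals all_analysis.
From mathcomp Require Import measurable_realfun.
From mathcomp.real_closed Require Import complex polyrcf.
From mathcomp Require Import ring lra.
Import Order.TTheory GRing.Theory Num.Theory.
Import numFieldNormedType.Exports.
Local Open Scope classical_set_scope.
Local Open Scope ring_scope.

(** * Borel functions on row vectors *)

(** The carrier is still ['rV[R]_d], and the measurable sets are those of [borel_rV], so functions
    on row vectors can be read on [borelT R d] directly. *)
Notation borelT R d := (g_sigma_algebraType [set U : set 'rV[R]_d | open U]).

Lemma borel_funE (R : realType) (d : nat) (f : 'rV[R]_d -> R) :
  borel_fun f <-> measurable_fun setT (f : borelT R d -> R).
Proof.
split=> [bf _ B mB|mf B mB]; first by rewrite setTI; exact: bf.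
by have := mf measurableT B mB; rewrite setTI.
Qed.

Lemma measurable_coord (R : realType) (d : nat) (i : 'I_d) :
  measurable_fun setT (fun t : borelT R d => (t : 'rV[R]_d) 0 i).
Proof.
apply: (measurability _ (RGenOpens.measurableE R)).
move=> _ [_ [a [b ->] <-]]; rewrite setTI; apply: sub_sigma_algebra => /=.
apply: (@open_comp _ _ (fun t : 'rV[R]_d => t 0 i)); last exact: interval_open.
by move=> t _; exact: coord_continuous.
Qed.

(** Second countability: the boxes are indexed by a countable type, rational centres with radii
    [1/(n+1)], so a property stable under countable unions need only be checked on boxes. *)
Lemma rV_open_ball (R : realType) (d : nat) (U : set 'rV[R]_d) : open U ->
  U = \bigcup_(q in [set q : 'rV[rat]_d * nat |
         [set t : 'rV[R]_d | forall i, `|t 0 i - ratr (q.1 0 i)| < q.2.+1%:R^-1] `<=` U])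
      [set t : 'rV[R]_d | forall i, `|t 0 i - ratr (q.1 0 i)| < q.2.+1%:R^-1].
Proof.
move=> oU; rewrite eqEsubset; split; last by move=> t [q qU]; exact: qU.
move=> t Ut; have /nbhs_ballP [e /= e0 teU] := open_nbhs_nbhs (conj oU Ut).
(* The radius [r] is less than [e / 2]: two points of a box differ by less than [2 * r] in each
   coordinate. *)
pose k := Num.truncn (2 / e).
have ke : 2 * k.+1%:R^-1 < e.
  by rewrite ltr_pdivrMr// mulrC -ltr_pdivrMr// truncnS_gt.
have k0 : 0 < k.+1%:R^-1 :> R by rewrite invr_gt0.
move: ke k0; set r := k.+1%:R^-1 => ke k0.
have /choice[q hq] : forall i : 'I_d, exists q : rat, `|t 0 i - ratr q| < r.
  move=> i; have : t 0 i - r < t 0 i + r by lra.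
  move=> /rat_in_itvoo[q]; rewrite in_itv/= => /andP[h1 h2].
  exists q; rewrite ltr_norml; apply/andP; split; lra.
exists (\row_i q i, k) => /=; last by move=> i; rewrite mxE; exact: hq.
move=> u /= hu; apply: teU; split=> // j i; rewrite [j]ord1 /ball/=.
have := hq i; have := hu i; rewrite mxE.
rewrite -/r => h1 h2.
rewrite (_ : t 0 i - u 0 i = (t 0 i - ratr (q i)) - (u 0 i - ratr (q i))); last by ring.
by apply: le_lt_trans (ler_normB _ _) _; lra.
Qed.

(** An open set is a countable union of boxes, and the preimage of a box is a finite intersection of
    preimages under coordinates, written below as the complement of a finite union. *)
Lemma measurable_rV {d'} {S : measurableType d'} (R : realType) (d : nat)
    (phi : S -> 'rV[R]_d) :
  (forall i, measurable_fun setT (fun s => phi s 0 i)) ->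
  measurable_fun setT (phi : S -> borelT R d).
Proof.
move=> mphi; apply: (@measurability _ _ S (borelT R d) setT phi
  [set U : set 'rV[R]_d | open U]) => //.
move=> _ [U oU <-]; rewrite setTI.
rewrite (@rV_open_ball R d U oU) preimage_bigcup bigcup_mkcond.
apply: countable_bigcupT_measurable; first exact: countableP.
move=> q; case: ifP => _ //.
rewrite (_ : _ @^-1` _ = ~` \bigcup_(i in [set: 'I_d]) ((fun s => phi s 0 i) @^-1`
   ~` ball (ratr (q.1 0 i) : R) q.2.+1%:R^-1)).
  apply: measurableC; apply: fin_bigcup_measurable; first exact: finite_finset.
  move=> i _; rewrite -[X in measurable X]setTI; apply: mphi => //.
  by apply: measurableC; apply: open_measurable; exact: ball_open.
rewrite setC_bigcup predeqE => s; split=> h i.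
  by move=> _ /=; apply; rewrite /ball/= distrC; exact: h.
by have := h i I; rewrite /= => /contrapT; rewrite /ball/= distrC.
Qed.

(** The measure is the image of the product measure under [phi], and the formula is Tonelli's
    theorem. An exhaustion by rectangles is carried over by [psi]. *)
Lemma sigma_finite_prod_transport {d1 d2 d3} {X1 : measurableType d1}
    {X2 : measurableType d2} {Y : measurableType d3} (R : realType)
    (m1 : {sigma_finite_measure set X1 -> \bar R})
    (m2 : {sigma_finite_measure set X2 -> \bar R})
    (phi : X1 * X2 -> Y) (psi : Y -> X1 * X2) :
  measurable_fun setT phi -> measurable_fun setT psi -> cancel phi psi ->
  exists nu : {sigma_finite_measure set Y -> \bar R},
    forall f : Y -> \bar R, measurable_fun setT f -> (forall y, 0 <= f y)%E ->
      (\int[nu]_y f y = \int[m1]_x \int[m2]_y f (phi (x, y)))%E.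
Proof.
move=> mphi mpsi phiK.
have sf : sigma_finite setT (pushforward (m1 \x m2)%E phi).
  have /sigma_finiteP[F [TF ndF Foo]] := sigma_finiteT m1.
  have /sigma_finiteP[G [TG ndG Goo]] := sigma_finiteT m2.
  exists (fun n => psi @^-1` (F n `*` G n)).
    rewrite -preimage_bigcup (_ : \bigcup_i _ = setT) ?preimage_setT//.
    rewrite predeqE => -[x y]; split=> // _.
    have [n _ Fnx] : (\bigcup_i F i) x by rewrite -TF.
    have [k _ Gky] : (\bigcup_i G i) y by rewrite -TG.
    (* Both exhaustions are nondecreasing, so a common index serves the two factors. *)
    exists (maxn n k) => //; split => /=.
    - by move: x Fnx; exact/subsetPset/ndF/leq_maxl.
    - by move: y Gky; exact/subsetPset/ndG/leq_maxr.
  move=> n; have [mF Fn] := Foo n; have [mG Gn] := Goo n; split.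
    by rewrite -[X in measurable X]setTI; apply: mpsi => //; exact: measurableX.
  rewrite /pushforward (_ : _ @^-1` _ = F n `*` G n).
    by rewrite product_measure1E// lte_mul_pinfty// ge0_fin_numE.
  by rewrite predeqE => x /=; rewrite phiK.
pose nu : {sigma_finite_measure set Y -> \bar R} :=
  HB.pack (pushforward (m1 \x m2)%E phi)
    (Measure.on (pushforward (m1 \x m2)%E phi))
    (Measure_isSigmaFinite.Build _ _ _ (pushforward (m1 \x m2)%E phi) sf).
(* [nu] is abstracted over the measurability of [phi], which is supplied here. *)
exists (nu mphi mphi mphi) => f mf f0.
rewrite ge0_integral_pushforward// fubini_tonelli1//.
  exact: measurableT_comp.
by move=> x; exact: f0.
Qed.

Lemma measurable_row_mx (R : realType) (n : nat) :
  measurable_fun setT (fun p : measurableTypeR R * borelT R n =>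
    row_mx (\row_(i < 1) p.1) (p.2 : 'rV[R]_n) : borelT R n.+1).
Proof.
apply: measurable_rV => i.
case: (split_ordP (i : 'I_(1 + n))) => j ->.
  apply: (eq_measurable_fun fst) => // p _.
  by rewrite (row_mxEl (\row_(i < 1) p.1)) mxE.
apply: (eq_measurable_fun (fun p : measurableTypeR R * borelT R n => (p.2 : 'rV[R]_n) 0 j)).
  by move=> p _; rewrite (row_mxEr (\row_(i < 1) p.1)).
apply: (measurableT_comp (@measurable_coord R n j)); exact: measurable_snd.
Qed.

Lemma measurable_row_split (R : realType) (n : nat) :
  measurable_fun setT (fun t : borelT R n.+1 =>
    ((t : 'rV[R]_(1 + n)) 0 (lshift n ord0), rsubmx (t : 'rV[R]_(1 + n)))
     : measurableTypeR R * borelT R n).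
Proof.
apply: measurable_fun_pair; first exact: measurable_coord.
apply: measurable_rV => i.
apply: (eq_measurable_fun (fun t : borelT R n.+1 => (t : 'rV[R]_(1 + n)) 0 (rshift 1 i))).
  by move=> p _; rewrite mxE.
exact: measurable_coord.
Qed.

(** Induction on [d]: the Dirac mass at the only row vector in dimension 0, then the product with
    Lebesgue measure moved along [row_mx]. *)
Lemma iint_measure (R : realType) (d : nat) :
  exists mu : {sigma_finite_measure set (borelT R d) -> \bar R},
    forall F : 'rV[R]_d -> \bar R, measurable_fun setT (F : borelT R d -> \bar R) ->
      (forall t, 0 <= F t)%E -> iint F = (\int[mu]_t F t)%E.
Proof.
elim: d => [|n [mu hmu]].
  pose mu0 : {sigma_finite_measure set (borelT R 0) -> \bar R} :=
    @dirac _ (borelT R 0) (0 : 'rV[R]_0) R.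
  exists mu0 => F mF F0 /=.
  by rewrite (@integral_dirac _ (borelT R 0))// diracT mul1e.
have [|nu hnu] := @sigma_finite_prod_transport _ _ _ _ _ _ R (@lebesgue_measure R) mu _ _
  (@measurable_row_mx R n) (@measurable_row_split R n).
  case=> x v /=; congr pair; last exact: row_mxKr.
  by rewrite (row_mxEl (\row_(i < 1) x)) mxE.
exists nu => F mF F0.
rewrite hnu//=.
apply: eq_integral => x _.
rewrite hmu//.
apply: (measurableT_comp mF).
exact: (measurableT_comp (@measurable_row_mx R n) (pair1_measurable x)).
Qed.

(** * Lebesgue measure on row vectors *)

(** The choice is harmless: the values of [iint] on indicators determine the measure. *)
Definition lebesgue_rV (R : realType) (d : nat) :
  {sigma_finite_measure set (borelT R d) -> \bar R} := sval (cid (iint_measure R d)).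

Lemma iintE (R : realType) (d : nat) (F : 'rV[R]_d -> \bar R) :
  measurable_fun setT (F : borelT R d -> \bar R) -> (forall t, 0 <= F t)%E ->
  iint F = (\int[lebesgue_rV R d]_t F t)%E.
Proof. by rewrite /lebesgue_rV; case: cid => mu /= h; exact: h. Qed.

Lemma lebRdE (R : realType) (d : nat) (A : set (borelT R d)) : measurable A ->
  lebRd A = lebesgue_rV R d A.
Proof.
move=> mA; rewrite /lebRd iintE ?integral_indic ?setIT//.
by apply/measurable_EFinP; exact: measurable_indic.
Qed.

Lemma iint_cst0 (R : realType) (d : nat) : iint (fun _ : 'rV[R]_d => 0%E) = 0%E.
Proof. by elim: d => //= n ->; rewrite integral0. Qed.

(** Lebesgue measure is determined by its values on half-open intervals, and a reflection keeps
    their length, although it swaps the closed and the open end. *)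
Lemma integral_reflect (R : realType) (c : R) (f : R -> \bar R) :
  measurable_fun setT f -> (forall x, 0 <= f x)%E ->
  (\int[@lebesgue_measure R]_x f (c - x)%R = \int[@lebesgue_measure R]_x f x)%E.
Proof.
move=> mf f0.
have mphi : measurable_fun setT (fun x : measurableTypeR R => c - x : measurableTypeR R).
  exact: measurable_funB.
rewrite -(ge0_integral_pushforward mphi _ measurableT mf)//.
apply: eq_measure_integral => //= A mA _; apply/esym/lebesgue_measure_unique => //.
move=> _ [[a b]] _ <-.
rewrite -[RHS]/(lebesgue_measure ((fun x : R => c - x) @^-1` `]a, b]%classic)).
rewrite (_ : _ @^-1` _ = `[c - b, c - a[%classic); last first.
  rewrite predeqE => x /=; rewrite !in_itv/=.
  by split=> /andP[h1 h2]; apply/andP; split; lra.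
rewrite !lebesgue_measure_itv/= !lte_fin ltrD2l ltrN2 -!EFinB.
by rewrite (_ : c - a - (c - b) = b - a)//; ring.
Qed.

(** The coordinates are reflected one at a time: the first by [integral_reflect], the others by the
    induction hypothesis. *)
Lemma iint_reflect (R : realType) (d : nat) (c : 'rV[R]_d) (F : 'rV[R]_d -> \bar R) :
  measurable_fun setT (F : borelT R d -> \bar R) -> (forall t, 0 <= F t)%E ->
  iint (fun t => F (c - t)) = iint F.
Proof.
elim: d c F => [|n IHn] c F mF F0 /=.
  by rewrite (thinmx0 (c - 0)).
have mFr : measurable_fun setT (fun p : measurableTypeR R * borelT R n =>
    F (row_mx (\row_(i < 1) p.1) (p.2 : 'rV[R]_n))).
  exact: (measurableT_comp mF (@measurable_row_mx R n)).
pose c0 : R := (c : 'rV[R]_(1 + n)) 0 (lshift n ord0).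
pose c1 : 'rV[R]_n := rsubmx (c : 'rV[R]_(1 + n)).
pose G (x : R) := iint (fun v : 'rV[R]_n => F (row_mx (\row_(i < 1) x) v)).
have mFx x : measurable_fun setT ((fun v => F (row_mx (\row_(i < 1) x) v)) : borelT R n -> \bar R).
  exact: (measurableT_comp mFr (pair1_measurable x)).
have GE x : G x = (\int[lebesgue_rV R n]_v F (row_mx (\row_(i < 1) x) v))%E.
  by rewrite /G iintE.
(* The inner integral is measurable by Tonelli's theorem, once [iint] is written as an integral
   against a measure. *)
have mG : measurable_fun setT (G : measurableTypeR R -> \bar R).
  rewrite (funext GE : G = _).
  exact: (@measurable_fun_fubini_tonelli_F _ _ _ _ _ (lebesgue_rV R n) _ mFr (fun p => F0 _)).
have G0 x : (0 <= G x)%E by rewrite GE integral_ge0.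
rewrite -[RHS](integral_reflect R c0 _ mG G0).
apply: eq_integral => x _.
rewrite -[RHS](IHn c1)//; congr iint; apply/funext => v; congr F.
have cE : c = row_mx (lsubmx (c : 'rV[R]_(1 + n))) c1 by rewrite hsubmxK.
transitivity (row_mx (lsubmx (c : 'rV[R]_(1 + n))) c1 - row_mx (\row_(i < 1) x) v).
  by rewrite -cE.
rewrite opp_row_mx add_row_mx.
suff -> : lsubmx (c : 'rV[R]_(1 + n)) - \row_(i < 1) x = \row_(i < 1) (c0 - x) by [].
by apply/rowP => i; rewrite (ord1 i) !mxE; congr (_ - _); congr (c _ _); exact: val_inj.
Qed.

Lemma iint_hyperplane (R : realType) (d : nat) (a : 'cV[R]_d) (c : R) : a != 0 ->
  lebRd [set t : 'rV[R]_d | (t *m a) 0 0 = c] = 0%E.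
Proof.
rewrite /lebRd; elim: d a c => [|n IHn] a c a0.
  by move: a0; rewrite (flatmx0 a) eqxx.
rewrite /=.
pose a1 : 'M[R]_(1, 1) := usubmx (a : 'M[R]_(1 + n, 1)).
pose a' : 'cV[R]_n := dsubmx (a : 'M[R]_(1 + n, 1)).
have aE : a = col_mx a1 a' by rewrite vsubmxK.
have rowE (x : R) (v : 'rV[R]_n) :
    (row_mx (\row_(i < 1) x) v *m (a : 'M[R]_(1 + n, 1))) 0 0 = x * a1 0 0 + (v *m a') 0 0.
  by rewrite aE mul_row_col mxE; congr (_ + _); rewrite mxE big_ord1 mxE.
(* If [a'] is nonzero, every slice at fixed [x] is a hyperplane in dimension [n]. Otherwise the
   equation confines [x] to the single point [c / a1 0 0], which is removed from the domain of
   integration. *)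
have [a'0|a'0] := eqVneq a' 0; last first.
  rewrite -[RHS](integral0 (@lebesgue_measure R) setT); apply: eq_integral => x _ /=.
  rewrite -[RHS](IHn a' (c - x * a1 0 0) a'0); congr iint; apply/funext => v.
  rewrite /indic; congr ((nat_of_bool _)%:R%:E).
  by apply/idP/idP; rewrite !inE/= rowE => h; lra.
have a1n0 : a1 0 0 != 0.
  apply: contra_neq a0 => a10; rewrite aE a'0 (_ : a1 = 0) ?col_mx0//.
  by apply/matrixP => i j; rewrite !ord1 a10 mxE.
pose f (x : R) :=
  iint (fun v : 'rV[R]_n => (\1_[set t : 'rV[R]_(1 + n) | (t *m a) 0 0 = c]
    (row_mx (\row_(i < 1) x) v))%:E).
have f0 x : (setT `\ (c / a1 0 0)) x -> f x = 0%E.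
  move=> -[_ xne]; rewrite -[RHS](iint_cst0 R n); congr iint; apply/funext => v.
  have va' : (v *m a') 0 0 = 0 by rewrite a'0 mulmx0 mxE.
  rewrite /indic memNset// /= rowE va' addr0 => xc.
  by apply: xne; rewrite -xc mulfK.
rewrite -[LHS](@integral_setD1 _ f (c / a1 0 0)); last 2 first.
- exact: measurableD.
- by apply: (eq_measurable_fun (cst 0%E)) => // x; rewrite inE => /f0.
rewrite -[RHS](integral0 (@lebesgue_measure R) (setT `\ (c / a1 0 0))).
by apply: eq_integral => x; rewrite inE => /f0.
Qed.

(** * Square-integrable functions *)

Lemma measurable_reflect (R : realType) (d : nat) (c : 'rV[R]_d) :
  measurable_fun setT (fun t : borelT R d => c - t : borelT R d).
Proof.
apply: measurable_rV => i.
apply: (eq_measurable_fun (fun t : borelT R d => c 0 i - (t : 'rV[R]_d) 0 i)).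
  by move=> t _; rewrite !mxE.
by apply: measurable_funB => //; exact: measurable_coord.
Qed.

Lemma measurable_mulmx_col (R : realType) (d : nat) (a : 'cV[R]_d) :
  measurable_fun setT (fun t : borelT R d => ((t : 'rV[R]_d) *m a) 0 0).
Proof.
apply: (eq_measurable_fun (fun t : borelT R d => \sum_j (t : 'rV[R]_d) 0 j * a j 0)).
  by move=> t _; rewrite mxE.
apply: measurable_sum => j.
by apply: measurable_funM => //; exact: measurable_coord.
Qed.

Lemma measurable_cos (R : realType) : measurable_fun setT (@cos R).
Proof. by apply: continuous_measurable_fun; exact: continuous_cos. Qed.

Lemma measurable_sin (R : realType) : measurable_fun setT (@sin R).
Proof. by apply: continuous_measurable_fun; exact: continuous_sin. Qed.

(** Integrability ensures that each [fine] in [rint] acts on a finite value; linearity of [rint] is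
    obtained through this identification. *)
Lemma rintE (R : realType) (d : nat) (F : borelT R d -> R) :
  (lebesgue_rV R d).-integrable setT (EFin \o F) ->
  rint F = (\int[lebesgue_rV R d]_t F t)%R.
Proof.
move=> iF; have mF := measurable_int _ iF.
have mF' : measurable_fun setT F by apply/measurable_EFinP.
rewrite /rint !iintE.
- rewrite /Rintegral [X in _ = fine X](integralE _ _ (fun t => (F t)%:E)) [RHS]fineB.
  + by rewrite -/(EFin \o F) funerpos funerneg.
  + exact: integrable_pos_fin_num.
  + exact: integrable_neg_fin_num.
- by apply/measurable_EFinP; exact: measurable_funrneg.
- by move=> t; rewrite lee_fin.
- by apply/measurable_EFinP; exact: measurable_funrpos.
- by move=> t; rewrite lee_fin.
Qed.

Lemma rint_reflect (R : realType) (d : nat) (c : 'rV[R]_d) (F : borelT R d -> R) :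
  measurable_fun setT F -> rint (fun t : 'rV[R]_d => F (c - t)) = rint F.
Proof.
move=> mF; rewrite /rint; congr (fine _ - fine _).
- apply: (iint_reflect R d c (fun t => (F^\+ t)%:E)).
    by apply/measurable_EFinP; exact: measurable_funrpos.
  by move=> t; rewrite lee_fin.
- apply: (iint_reflect R d c (fun t => (F^\- t)%:E)).
    by apply/measurable_EFinP; exact: measurable_funrneg.
  by move=> t; rewrite lee_fin.
Qed.

Lemma L2P (R : realType) (d : nat) (f : borelT R d -> R) :
  L2 f <-> measurable_fun setT f /\
    (lebesgue_rV R d).-integrable setT (fun t => (f t ^+ 2)%:E).
Proof.
have E : measurable_fun setT f ->
    iint (fun t => (f t ^+ 2)%:E) = (\int[lebesgue_rV R d]_t `|(f t ^+ 2)%:E|)%E.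
  move=> mf; rewrite iintE.
  - by apply: eq_integral => t _; rewrite gee0_abs// lee_fin sqr_ge0.
  - by apply/measurable_EFinP; exact: measurable_funX.
  - by move=> t; rewrite lee_fin sqr_ge0.
split=> [[/borel_funE mf foo]|[mf /integrableP[_ foo]]].
  split=> //; apply/integrableP; split; last by rewrite -E.
  by apply/measurable_EFinP; exact: measurable_funX.
by split; [exact/borel_funE | rewrite E].
Qed.

Lemma L2_reflect (R : realType) (d : nat) (c : 'rV[R]_d) (f : borelT R d -> R) :
  L2 f -> L2 (fun t : 'rV[R]_d => f (c - t)).
Proof.
move=> [/borel_funE mf foo]; split.
  by apply/borel_funE; exact: (measurableT_comp mf (measurable_reflect R d c)).
rewrite (iint_reflect R d c (fun t => (f t ^+ 2)%:E))//.
  by apply/measurable_EFinP; exact: measurable_funX.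
by move=> t; rewrite lee_fin sqr_ge0.
Qed.

(** A translation is the composite of the reflections [t |-> - t] and [t |-> x - t]. *)
Lemma L2_translate (R : realType) (d : nat) (x : 'rV[R]_d) (f : borelT R d -> R) :
  L2 f -> L2 (fun t : 'rV[R]_d => f (t - x)).
Proof.
move=> /(L2_reflect R d 0)/(L2_reflect R d x); congr L2; apply/funext => t.
by rewrite sub0r opprB.
Qed.

Lemma L2_mul_bounded (R : realType) (d : nat) (M : R) (p f : borelT R d -> R) :
  measurable_fun setT p -> (forall t, `|p t| <= M) -> L2 f -> L2 (fun t => p t * f t).
Proof.
move=> mp pM /L2P[mf iF]; apply/L2P; split; first exact: measurable_funM.
have := @integrableZl _ _ _ (lebesgue_rV R d) setT measurableT (M ^+ 2) _ iF.
apply: le_integrable => //.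
  by apply/measurable_EFinP; apply: measurable_funX; exact: measurable_funM.
move=> t _ /=; rewrite lee_fin -exprMn !normrX lerXn2r ?nnegrE// !normrM.
by rewrite ler_wpM2r// (le_trans (pM t))// ler_norm.
Qed.

Lemma L2_mul_integrable (R : realType) (d : nat) (f g : borelT R d -> R) :
  L2 f -> L2 g -> (lebesgue_rV R d).-integrable setT (EFin \o (fun t => f t * g t)).
Proof.
move=> /L2P[mf iF] /L2P[mg ig].
have := integrableD measurableT iF ig; apply: le_integrable => //.
  by apply/measurable_EFinP; exact: measurable_funM.
move=> t _ /=; rewrite lee_fin normrM [leRHS]ger0_norm.
  (* The bound is [|f g| <= f ^ 2 + g ^ 2]. *)
  have : 0 <= (`|f t| - `|g t|) ^+ 2 by exact: sqr_ge0.
  have := sqr_ge0 (f t); have := sqr_ge0 (g t).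
  rewrite -(real_normK (num_real (f t))) -(real_normK (num_real (g t))) => *; nra.
by rewrite addr_ge0// sqr_ge0.
Qed.

(** * The short-time Fourier transform *)

Definition phase (R : realType) (d : nat) (w t : 'rV[R]_d) : R := - (2 * pi * dotp w t).

Lemma phaseB (R : realType) (d : nat) (w x t : 'rV[R]_d) :
  phase R d w (x - t) = phase R d w x - phase R d w t.
Proof.
rewrite /phase (_ : dotp w (x - t) = dotp w x - dotp w t); first by ring.
by rewrite /dotp -sumrB; apply: eq_bigr => i _; rewrite !mxE mulrBr.
Qed.

Lemma measurable_phase (R : realType) (d : nat) (w : 'rV[R]_d) :
  measurable_fun setT (phase R d w : borelT R d -> R).
Proof.
apply: measurableT_comp => //; apply: measurable_funM => //.
apply: measurable_sum => i; apply: measurable_funM => //; exact: measurable_coord.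
Qed.

Lemma STFTE (R : realType) (d : nat) (g f : 'rV[R]_d -> R) (x w : 'rV[R]_d) :
  STFT g f x w = Complex (rint (fun t => f t * g (t - x) * cos (phase R d w t)))
                         (rint (fun t => f t * g (t - x) * sin (phase R d w t))).
Proof.
rewrite /STFT /cint; congr Complex; congr rint; apply/funext => t /=;
  by rewrite /phase; ring.
Qed.

Lemma integrable_mul_bounded (R : realType) (d : nat) (k b : borelT R d -> R) :
  measurable_fun setT b -> (forall t, `|b t| <= 1) ->
  (lebesgue_rV R d).-integrable setT (EFin \o k) ->
  (lebesgue_rV R d).-integrable setT (EFin \o (fun t => k t * b t)).
Proof.
move=> mb b1 ik; apply: le_integrable (ik) => //.
  apply/measurable_EFinP; apply: measurable_funM => //.
  by apply/measurable_EFinP; exact: measurable_int ik.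
by move=> t _ /=; rewrite lee_fin normrM ler_piMr.
Qed.

(* Reflecting the integrand turns the Fourier integral of a real function into
   its complex conjugate up to a unimodular factor. *)
Lemma STFT_norm_reflect (R : realType) (d : nat) (g f h : 'rV[R]_d -> R)
    (x w : 'rV[R]_d) : L2 g -> L2 f ->
  (forall t, h t * g (t - x) = f (x - t) * g ((x - t) - x)) ->
  `|STFT g f x w| = `|STFT g h x w|.
Proof.
move=> Lg Lf fh; rewrite !STFTE !normc_def /=; congr (Num.sqrt _)%:C%C.
set k := fun t : borelT R d => f t * g (t - x).
have ik : (lebesgue_rV R d).-integrable setT (EFin \o k).
  by apply: L2_mul_integrable => //; exact: L2_translate.
pose ph : borelT R d -> R := phase R d w.
pose C t := cos (ph t); pose S t := sin (ph t).
have mC : measurable_fun setT C.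
  by apply: measurableT_comp; [exact: measurable_cos|exact: measurable_phase].
have mS : measurable_fun setT S.
  by apply: measurableT_comp; [exact: measurable_sin|exact: measurable_phase].
have iC : (lebesgue_rV R d).-integrable setT (EFin \o (fun t => k t * C t)).
  by apply: integrable_mul_bounded => // t; exact: cos_max.
have iS : (lebesgue_rV R d).-integrable setT (EFin \o (fun t => k t * S t)).
  by apply: integrable_mul_bounded => // t; exact: sin_max.
have lin (a b : R) : rint (fun t => a * (k t * C t) + b * (k t * S t)) =
    a * rint (fun t => k t * C t) + b * rint (fun t => k t * S t).
  have iaC := @integrableZl _ _ _ (lebesgue_rV R d) setT measurableT a _ iC.
  have ibS := @integrableZl _ _ _ (lebesgue_rV R d) setT measurableT b _ iS.
  rewrite !rintE//; last exact: (integrableD measurableT iaC ibS).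
  by rewrite RintegralD// !RintegralZl.
have mkr (b : borelT R d -> R) : measurable_fun setT b ->
    measurable_fun setT (fun t => k t * b t).
  move=> mb; apply: measurable_funM => //.
  by apply/measurable_EFinP; exact: measurable_int ik.
have refl (b : borelT R d -> R) : measurable_fun setT b ->
    rint (fun t => h t * g (t - x) * b t) = rint (fun t => k t * b (x - t)).
  move=> mb.
  rewrite -(rint_reflect R d x (fun t => k t * b (x - t))).
    by congr rint; apply/funext => t; rewrite fh /k subKr.
  apply: mkr; exact: (measurableT_comp mb (measurable_reflect R d x)).
rewrite -/ph -/C -/S (refl C mC) (refl S mS).
(* The addition formulas express the reflected integrals through the original pair by the matrix
   with rows [(C x, S x)] and [(S x, - C x)]. It is orthogonal, so the sum of squares is
   unchanged. *)
have -> : (fun t => k t * C (x - t)) = (fun t => C x * (k t * C t) + S x * (k t * S t)).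
  by apply/funext => t; rewrite /C /ph phaseB cosB /S /ph; ring.
have -> : (fun t => k t * S (x - t)) = (fun t => S x * (k t * C t) + - C x * (k t * S t)).
  by apply/funext => t; rewrite /S /ph phaseB sinB /C /ph; ring.
rewrite !lin.
have CS : C x ^+ 2 + S x ^+ 2 = 1 by exact: cos2Dsin2.
rewrite -[LHS]mul1r -CS; ring.
Qed.

(** * Null sets *)

Lemma measurable_neqr {d'} {T : measurableType d'} (R : realType) (f h : T -> R) :
  measurable_fun setT f -> measurable_fun setT h ->
  measurable [set t | f t != h t].
Proof.
move=> mf mh; rewrite (_ : [set t | _] = setT `&` (fun t => f t == h t) @^-1` [set false]).
  exact: (measurable_fun_eqr mf mh).
by rewrite setTI predeqE => t /=; split=> [/negbTE|->].
Qed.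

Lemma lebRd_eq0 (R : realType) (d : nat) (A : set (borelT R d)) : measurable A ->
  lebRd A = 0%E <-> (lebesgue_rV R d).-negligible A.
Proof. by move=> mA; rewrite lebRdE// negligibleP. Qed.

Lemma negligible_reflect (R : realType) (d : nat) (c : 'rV[R]_d) (A : set (borelT R d)) :
  measurable A -> (lebesgue_rV R d).-negligible A ->
  (lebesgue_rV R d).-negligible [set t | A (c - (t : 'rV[R]_d))].
Proof.
move=> mA /(lebRd_eq0 _ _ _ mA) A0.
have mA' : measurable [set t : borelT R d | A (c - (t : 'rV[R]_d))].
  by rewrite -[X in measurable X]setTI; exact: (measurable_reflect R d c).
apply/(lebRd_eq0 _ _ _ mA'); rewrite -A0.
apply: (iint_reflect R d c (fun t => (\1_A t)%:E)).
  by apply/measurable_EFinP; exact: measurable_indic.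
by move=> t; rewrite lee_fin.
Qed.

Lemma rint_null (R : realType) (d : nat) (F : borelT R d -> R) :
  measurable_fun setT F -> (lebesgue_rV R d).-negligible [set t | F t != 0] -> rint F = 0.
Proof.
move=> mF F0.
have null (P : borelT R d -> R) : measurable_fun setT P -> (forall t, 0 <= P t) ->
    (forall t, F t = 0 -> P t = 0) -> iint (fun t => (P t)%:E) = 0%E.
  move=> mP P0 FP; rewrite iintE; [|exact/measurable_EFinP|by move=> t; rewrite lee_fin].
  rewrite -[RHS](integral0 (lebesgue_rV R d) setT).
  apply: ge0_ae_eq_integral => //.
  - exact/measurable_EFinP.
  - by move=> t _; rewrite lee_fin.
  - apply: negligibleS F0 => t /= PF; apply: contra_not_neq PF => Ft0 _.
    by rewrite FP.
rewrite /rint !null ?subr0//.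
- exact: measurable_funrneg.
- by move=> t Ft; rewrite /funrneg Ft oppr0 maxxx.
- exact: measurable_funrpos.
- by move=> t Ft; rewrite /funrpos Ft maxxx.
Qed.

Lemma STFT_null (R : realType) (d : nat) (g f : 'rV[R]_d -> R) (x w : 'rV[R]_d) :
  borel_fun g -> borel_fun f -> lebRd [set t | g t != 0] = 0%E -> STFT g f x w = 0.
Proof.
move=> /borel_funE mg /borel_funE mf g0.
have mg0 : measurable [set t : borelT R d | g t != 0] by exact: measurable_neqr.
have {}g0 : (lebesgue_rV R d).-negligible [set t | g (t - x) != 0].
  have := g0 => /(lebRd_eq0 _ _ _ mg0)/(negligible_reflect R d 0 _ mg0) {}g0.
  have mg1 : measurable [set t : borelT R d | g (0 - (t : 'rV[R]_d)) != 0].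
    by apply: measurable_neqr => //; exact: (measurableT_comp mg (measurable_reflect R d 0)).
  have := negligible_reflect R d x _ mg1 g0.
  by congr (_.-negligible _); rewrite predeqE => t /=; rewrite sub0r opprB.
have mgx : measurable_fun setT (fun t : borelT R d => g (t - x)).
  have := measurableT_comp (measurableT_comp mg (measurable_reflect R d 0))
    (measurable_reflect R d x).
  by apply: eq_measurable_fun => t _ /=; rewrite sub0r opprB.
have null (b : borelT R d -> R) : measurable_fun setT b ->
    rint (fun t => f t * g (t - x) * b t) = 0.
  move=> mb; apply: rint_null.
    by apply: measurable_funM => //; exact: measurable_funM.
  apply: negligibleS g0 => t /=; apply: contra_neq => ->.
  by rewrite mulr0 mul0r.
rewrite STFTE !null//.
- by apply: measurableT_comp; [exact: measurable_sin|exact: measurable_phase].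
- by apply: measurableT_comp; [exact: measurable_cos|exact: measurable_phase].
Qed.

Lemma negligible_hyperplanes (R : realType) (d : nat) (a : 'cV[R]_d) (c : int -> R) :
  a != 0 ->
  (lebesgue_rV R d).-negligible [set t | exists z : int, ((t : 'rV[R]_d) *m a) 0 0 = c z].
Proof.
move=> a0.
(* A code [n] of no integer falls back to [c 0], which repeats one of the hyperplanes. *)
pose F n := [set t : borelT R d | ((t : 'rV[R]_d) *m a) 0 0 = c (odflt 0 (unpickle n))].
apply: (@negligibleS _ _ _ _ (\bigcup_n F n)).
  by move=> t [z tz]; exists (pickle z) => //; rewrite /F /= pickleK.
apply: negligible_bigcup => n; apply/lebRd_eq0; last exact: iint_hyperplane.
rewrite (_ : F n = setT `&` (fun t : borelT R d => ((t : 'rV[R]_d) *m a) 0 0) @^-1`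
    [set c (odflt 0 (unpickle n))]).
  by apply: measurable_mulmx_col => //; exact: measurable_set1.
by rewrite setTI.
Qed.

(** * Fractional parts and unimodular factors *)

Definition fract (R : realType) (x : R) : R := x - (Num.floor x)%:~R.

Lemma fract_ge0 (R : realType) (x : R) : 0 <= fract R x.
Proof. by rewrite subr_ge0 floor_le. Qed.

Lemma fract_le1 (R : realType) (x : R) : fract R x <= 1.
Proof. by rewrite lerBlDl ltW// -intrD1 floorD1_gt. Qed.

Lemma fract_addz (R : realType) (x : R) (k : int) : fract R (x + k%:~R) = fract R x.
Proof. by rewrite /fract floorDrz ?intr_int// intrKfloor intrD; ring. Qed.

(** The equation reads [2 * x = floor x - floor (- x)]. The symmetry thus holds at half-integers
    only, a countable set. *)
Lemma fract_oppr (R : realType) (x : R) : fract R x = fract R (- x) ->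
  exists z : int, x = z%:~R / 2.
Proof.
rewrite /fract => h; exists (Num.floor x - Num.floor (- x)).
by rewrite intrB; lra.
Qed.

Lemma measurable_fract (R : realType) : measurable_fun setT (fract R).
Proof.
apply: measurable_funB => //; apply: nondecreasing_measurable => // x y xy.
by rewrite ler_int le_floor.
Qed.

(** Squaring removes the unknown factor. With [nu = a + i b] and real functions, [f = a h] and
    [b h = 0] almost everywhere, so [h ^ 2 = (a ^ 2 + b ^ 2) h ^ 2 = f ^ 2]. *)
Lemma sim_sqr (R : realType) (d : nat) (f h : 'rV[R]_d -> R) :
  borel_fun f -> borel_fun h -> sim f h ->
  (lebesgue_rV R d).-negligible [set t | f t ^+ 2 != h t ^+ 2].
Proof.
move=> /borel_funE mf /borel_funE mh [[a b] [nu1 fh]].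
have ab1 : a ^+ 2 + b ^+ 2 = 1.
  move: nu1; rewrite normc_def /= => -[/(congr1 (fun x => x ^+ 2))].
  by rewrite sqr_sqrtr ?addr_ge0 ?sqr_ge0// expr1n.
set E := [set t | RtoC (f t) != Complex a b * RtoC (h t)] in fh.
have EE : E = [set t : borelT R d | f t != a * h t] `|` [set t : borelT R d | b * h t != 0].
  rewrite predeqE => t; rewrite /E /= /RtoC; split.
  - move=> /eqP ne; apply/orP; rewrite -negb_and; apply/negP => /andP[/eqP e1 /eqP e2].
    by apply: ne; rewrite /GRing.mul/= !mulr0 subr0 add0r e1 e2.
  - move=> /orP; rewrite -negb_and; apply: contra => /eqP[].
    by rewrite !mulr0 subr0 add0r => -> <-; rewrite !eqxx.
have mE : measurable (E : set (borelT R d)).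
  rewrite EE; apply: measurableU; apply: measurable_neqr => //; exact: measurable_funM.
move/(lebRd_eq0 _ _ _ mE) : fh; apply: negligibleS => t /=.
rewrite EE /=; apply: contra_neqP => /not_orP[/negP/negPn/eqP -> /negP/negPn/eqP bh].
have -> : h t ^+ 2 = (a ^+ 2 + b ^+ 2) * h t ^+ 2 by rewrite ab1 mul1r.
by rewrite mulrDl -!exprMn bh expr0n /= addr0.
Qed.

(** * The periodic modulations *)

(** In the theorem [a] is a column of [invmx A], which makes [t *m a] a coordinate of [t] in the
    lattice basis. *)
Definition fract_col (R : realType) (d : nat) (a : 'cV[R]_d) (t : 'rV[R]_d) : R :=
  fract R ((t *m a) 0 0).

(* The exponent is [n.+1], not [n]: the constant [p = 1] would give [f = h]. *)
Definition modulated (R : realType) (d : nat) (a : 'cV[R]_d) (n : nat)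
    (G : 'rV[R]_d -> R) (t : 'rV[R]_d) : R := fract_col R d a t ^+ n.+1 * G t.

Definition modulated_reflect (R : realType) (d : nat) (a : 'cV[R]_d) (n : nat)
    (G : 'rV[R]_d -> R) (t : 'rV[R]_d) : R := fract_col R d a (- t) ^+ n.+1 * G t.

Lemma measurable_fract_col (R : realType) (d : nat) (a : 'cV[R]_d) :
  measurable_fun setT (fract_col R d a : borelT R d -> R).
Proof. by apply: measurableT_comp; [exact: measurable_fract|exact: measurable_mulmx_col]. Qed.

Lemma measurable_fract_colN (R : realType) (d : nat) (a : 'cV[R]_d) :
  measurable_fun setT (fun t : borelT R d => fract_col R d a (- (t : 'rV[R]_d))).
Proof.
have := measurableT_comp (measurable_fract_col R d a) (measurable_reflect R d 0).
by apply: eq_measurable_fun => t _ /=; rewrite sub0r.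
Qed.

Lemma fract_col_exp_le1 (R : realType) (d : nat) (a : 'cV[R]_d) (n : nat) (t : 'rV[R]_d) :
  `|fract_col R d a t ^+ n| <= 1.
Proof. by rewrite normrX exprn_ile1// ger0_norm ?fract_ge0 ?fract_le1. Qed.

Lemma L2_modulated (R : realType) (d : nat) (a : 'cV[R]_d) (n : nat) (G : 'rV[R]_d -> R) :
  L2 G -> L2 (modulated R d a n G).
Proof.
apply: (L2_mul_bounded R d 1) => [|t]; last exact: fract_col_exp_le1.
by apply: measurable_funX; exact: measurable_fract_col.
Qed.

Lemma L2_modulated_reflect (R : realType) (d : nat) (a : 'cV[R]_d) (n : nat)
    (G : 'rV[R]_d -> R) : L2 G -> L2 (modulated_reflect R d a n G).
Proof.
apply: (L2_mul_bounded R d 1 (fun t : borelT R d => fract_col R d a (- (t : 'rV[R]_d)) ^+ n.+1)).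
  by apply: measurable_funX; exact: measurable_fract_colN.
by move=> t; exact: fract_col_exp_le1.
Qed.

Lemma L2Z (R : realType) (d : nat) (k : R) (f : 'rV[R]_d -> R) :
  L2 f -> L2 (fun t => k * f t).
Proof. by apply: (L2_mul_bounded R d `|k| (cst k)) => //; exact: measurable_cst. Qed.

Lemma not_sim_modulated (R : realType) (d : nat) (a : 'cV[R]_d) (n : nat) (k : R)
    (G : 'rV[R]_d -> R) : a != 0 -> k != 0 -> L2 G ->
  ~ (lebesgue_rV R d).-negligible [set t | G t != 0] ->
  ~ sim (fun t => k * modulated R d a n G t) (fun t => k * modulated_reflect R d a n G t).
Proof.
move=> a0 k0 LG G0 fh; apply: G0.
have Lf := L2Z R d k _ (L2_modulated R d a n G LG).
have Lh := L2Z R d k _ (L2_modulated_reflect R d a n G LG).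
have := negligibleU (sim_sqr R d _ _ Lf.1 Lh.1 fh)
  (negligible_hyperplanes R d a (fun z => z%:~R / 2) a0).
apply: negligibleS => t /= Gt0.
have [fE|] := eqVneq (fract_col R d a t) (fract_col R d a (- t)).
  right; apply: fract_oppr; move: fE; rewrite /fract_col.
  by have -> : (- t *m a) 0 0 = - (t *m a) 0 0 by rewrite mulNmx mxE.
move=> ne; left; apply: contra_neq ne.
(* After cancelling [k ^ 2] and [G t ^ 2], equal even powers of two nonnegative numbers force the
   numbers to be equal. *)
rewrite /modulated /modulated_reflect !exprMn => /(mulfI (expf_neq0 2 k0)).
move=> /(mulIf (expf_neq0 2 Gt0)); rewrite -!exprM => /eqP.
by rewrite eqrXn2 ?fract_ge0 ?muln_gt0// => /eqP.
Qed.

(** If [N] functions spanned the family, its first [N + 1] members would satisfy a nontrivial linear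
    relation almost everywhere. This is [P(p) * G = 0] for a nonzero polynomial [P], so off a null
    set [p] is a root of [P] wherever [G] is nonzero. *)
Lemma infinite_dim_modulated (R : realType) (d : nat) (a : 'cV[R]_d) (G : 'rV[R]_d -> R)
    (C : set ('rV[R]_d -> R)) : a != 0 -> L2 G ->
  ~ (lebesgue_rV R d).-negligible [set t | G t != 0] ->
  (forall n, C (modulated R d a n G)) -> infinite_dim C.
Proof.
move=> a0 LG G0 CG [N [e [Le span]]]; apply: G0.
have /choice[c hc] : forall j : 'I_N.+1, exists c : 'I_N -> R,
    lebRd [set t | modulated R d a j G t != \sum_(i < N) c i * e i t] = 0%E.
  by move=> j; exact: (span _ (CG j)).
pose M := \matrix_(j < N.+1, i < N) c j i.
(* [M] has [N + 1] rows and rank at most [N], so its left kernel is nonzero. *)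
have [b /sub_kermxP bM b0] : exists2 b : 'rV_N.+1, (b <= kermx M)%MS & b != 0.
  apply/rowV0Pn; rewrite kermx_eq0 /row_free neq_ltn.
  by rewrite ltnS rank_leq_col.
pose P : {poly R} := \sum_(j < N.+1) b 0 j *: 'X^(j.+1).
have P0 : P != 0.
  apply: contra_neq b0 => P0; apply/rowP => j; rewrite mxE.
  have := congr1 (fun p : {poly R} => p`_(j.+1)) P0; rewrite coef0 coef_sum => <-.
  rewrite (bigD1 j)//= coefZ coefXn eqxx mulr1 big1 ?addr0// => i ij.
  by rewrite coefZ coefXn eqSS (inj_eq val_inj) eq_sym (negbTE ij) mulr0.
pose E (j : nat) := [set t : borelT R d | modulated R d a (inord j : 'I_N.+1) G t
   != \sum_(i < N) c (inord j) i * e i t].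
(* Past the end of the list of roots the default is 0; this only adds null sets. *)
pose H (k : nat) := [set t : borelT R d | exists z : int,
   ((t : 'rV[R]_d) *m a) 0 0 = (rootsR P)`_k + z%:~R].
have nE : (lebesgue_rV R d).-negligible (\bigcup_j E j).
  apply: negligible_bigcup => j; apply/lebRd_eq0; last exact: hc.
  apply: measurable_neqr; first by apply/borel_funE; exact: (L2_modulated R d a _ G LG).1.
  apply: measurable_sum => i; apply: measurable_funM => //.
  by apply/borel_funE; exact: (Le i).1.
have nH : (lebesgue_rV R d).-negligible (\bigcup_k H k).
  by apply: negligible_bigcup => k; exact: negligible_hyperplanes.
apply: negligibleS (negligibleU nE nH) => t /= Gt0.
have [tE|tE] := pselect ((\bigcup_j E j) t); first by left.
right.
have fE (j : 'I_N.+1) : modulated R d a j G t = \sum_(i < N) c j i * e i t.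
  apply/eqP/negPn/negP => ne; apply: tE; exists j => //.
  by rewrite /E /= inord_val.
have : P.[fract_col R d a t] * G t = 0.
  rewrite horner_sum mulr_suml.
  under eq_bigr do rewrite hornerZ hornerXn -mulrA
    -[_ ^+ _ * _]/(modulated R d a _ G t) fE mulr_sumr.
  rewrite exchange_big big1//= => i _.
  under eq_bigr do rewrite mulrA; rewrite -mulr_suml.
  have := congr1 (fun v : 'rV_N => v 0 i) bM; rewrite !mxE.
  by under eq_bigr do rewrite mxE; move=> ->; rewrite mul0r.
move=> /eqP; rewrite mulf_eq0 (negbTE Gt0) orbF => rt.
have rin : fract_col R d a t \in rootsR P by rewrite -(roots_on_rootsR P0) in_itv; exact: rt.
exists (index (fract_col R d a t) (rootsR P)) => //.
exists (Num.floor ((t *m a) 0 0)); rewrite nth_index//.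
by rewrite /fract_col /fract subrK.
Qed.

(** * The unit cube as a set of positive measure *)

Lemma iint_unit_cube (R : realType) (d : nat) :
  iint (fun t : 'rV[R]_d => (\1_[set t : 'rV[R]_d | forall i, 0 <= t 0 i <= 1] t)%:E) = 1%E.
Proof.
elim: d => [|n IHn] /=; first by rewrite /indic mem_set//; case.
transitivity (\int[@lebesgue_measure R]_x (\1_(`[0%R, 1%R]%classic : set R) x)%:E)%E.
  apply: eq_integral => x _.
  have rowE (v : 'rV[R]_n) i : (row_mx (\row_(i < 1) x) v : 'rV[R]_(1 + n)) 0 i =
      match fintype.split i with inl _ => x | inr j => v 0 j end.
    by rewrite mxE; case: fintype.split => j //; rewrite mxE.
  have [x01|x01] := boolP (0 <= x <= 1).
    rewrite [in RHS]indicE mem_set/= ?in_itv// -[RHS]IHn; congr iint; apply/funext => v.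
    rewrite /indic; congr ((nat_of_bool _)%:R%:E).
    apply/idP/idP; rewrite !inE/= => h i.
      by have := h (rshift 1 i); rewrite rowE (unsplitK (inr i)).
    by rewrite (rowE v (i : 'I_(1 + n))); case: fintype.split.
  rewrite [in RHS]indicE memNset/= ?in_itv ?(negbTE x01)// -[RHS](iint_cst0 R n).
  congr iint; apply/funext => v; rewrite /indic memNset//= => /(_ (@lshift 1 n ord0)).
  by rewrite rowE (unsplitK (inl (ord0 : 'I_1))) (negbTE x01).
rewrite integral_indic// setIT -[LHS]/(lebesgue_measure `[0%R, 1%R]%classic).
by rewrite lebesgue_measure_itv/= lte_fin ltr01 sube0.
Qed.

(** The indicator of the unit cube serves as [G] when the window is null. *)
Lemma exists_L2_not_null (R : realType) (d : nat) :
  exists G : 'rV[R]_d -> R, L2 G /\ ~ (lebesgue_rV R d).-negligible [set t | G t != 0].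
Proof.
pose Q := [set t : 'rV[R]_d | forall i, 0 <= t 0 i <= 1].
have mQ : measurable (Q : set (borelT R d)).
  rewrite (_ : Q = \bigcap_(i in [set: 'I_d]) ((fun t : borelT R d => (t : 'rV[R]_d) 0 i) @^-1`
      `[0, 1]%classic)).
    apply: fin_bigcap_measurable => [|i _]; first exact: finite_finset.
    by rewrite -[X in measurable X]setTI; apply: measurable_coord.
  rewrite predeqE => t; split=> h i; first by move=> _ /=; rewrite in_itv; exact: h.
  by have := h i I; rewrite /= in_itv.
exists (\1_Q); split.
  split; first by apply/borel_funE; exact: measurable_indic.
  rewrite (_ : (fun t => _) = (fun t => (\1_Q t)%:E)) ?iint_unit_cube ?ltry//.
  by apply/funext => t; rewrite indicE; case: (t \in Q); rewrite ?expr1n ?expr0n.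
rewrite (_ : [set t | _] = Q).
  by move/(lebRd_eq0 _ _ _ mQ); rewrite /lebRd iint_unit_cube => /eqP; rewrite onee_eq0.
rewrite predeqE => t; rewrite /= indicE; split=> [|Qt]; last by rewrite mem_set ?oner_eq0.
by case: (boolP (t \in Q)) => [/set_mem//|_]; rewrite eqxx.
Qed.

(** * Lattice periodicity and the conclusion *)

(** Adding the lattice point with coefficients [k] shifts the [i]-th coordinate by the integer
    [k 0 i]. *)
Lemma fract_col_lattice (R : realType) (d : nat) (A : 'M[R]_d) (i : 'I_d)
    (k : 'rV[int]_d) (t : 'rV[R]_d) : A \in unitmx ->
  fract_col R d (col i (invmx A)) (t + map_mx intr k *m A) = fract_col R d (col i (invmx A)) t.
Proof.
move=> uA; rewrite /fract_col.
have mulE (x : 'rV[R]_d) : (x *m col i (invmx A)) 0 0 = (x *m invmx A) 0 i.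
  by rewrite colE mulmxA -colE mxE.
rewrite !mulE mulmxDl mulmxK//.
have -> : (t *m invmx A + map_mx intr k) 0 i = (t *m invmx A) 0 i + (k 0 i)%:~R.
  by rewrite [LHS]mxE; congr (_ + _); rewrite mxE.
exact: fract_addz.
Qed.

Theorem theorem1p7 (R : realType) (d : nat) (hd : (0 < d)%N)
  (g : 'rV[R]_d -> R) (hg : L2 g)
  (L : set ('rV[R]_d * 'rV[R]_d))
  (hL : exists Lam : set 'rV[R]_d, is_lattice Lam /\ (forall z, L z -> Lam z.1)) :
  exists C : set ('rV[R]_d -> R), is_cone C /\ infinite_dim C /\ C `<=` NR g L.
Proof.
have [Lam [[A [uA LamE]] LLam]] := hL.
(* [hd] supplies a first coordinate; in dimension 0 the space of square-integrable functions is
   one-dimensional. *)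
pose a := col (Ordinal hd) (invmx A).
have a0 : a != 0.
  apply/eqP => a0; have : delta_mx (Ordinal hd) 0 = 0 :> 'cV[R]_d.
    by rewrite -[LHS](mulKVmx uA) -colE -/a a0 mulmx0.
  by move/colP/(_ (Ordinal hd)) => /eqP; rewrite !mxE !eqxx oner_eq0.
(* The cases of a null and a non-null window differ only in [G]; the rest of the proof uses just
   these three properties. *)
have [G [LG [G0 VG]]] : exists G : 'rV[R]_d -> R, L2 G /\
    ~ (lebesgue_rV R d).-negligible [set t | G t != 0] /\
    forall k n z, L z -> `|STFT g (fun t => k * modulated R d a n G t) z.1 z.2| =
                     `|STFT g (fun t => k * modulated_reflect R d a n G t) z.1 z.2|.
  have mg := (borel_funE R d g).1 hg.1.
  have mg0 : measurable [set t : borelT R d | g t != 0] by exact: measurable_neqr.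
  have [g0|g0] := pselect ((lebesgue_rV R d).-negligible [set t | g t != 0]).
    have [G [LG G0]] := exists_L2_not_null R d.
    exists G; split=> //; split=> // k n z Lz.
    have {}g0 : lebRd [set t | g t != 0] = 0%E by apply/(lebRd_eq0 R d _ mg0).
    have V0 f : L2 f -> STFT g f z.1 z.2 = 0 by move=> [bf _]; exact: STFT_null hg.1 bf g0.
    rewrite !V0//; apply: L2Z; first exact: L2_modulated_reflect.
    exact: L2_modulated.
  exists (fun t => g (- t)).
  have LG : L2 (fun t => g (- t)).
    by have := L2_reflect R d 0 g hg; congr L2; apply/funext => t; rewrite sub0r.
  split=> //; split=> [G0|k n [x w] Lz].
    have mGN : measurable [set t : borelT R d | g (- (t : 'rV[R]_d)) != 0].
      by apply: measurable_neqr => //; apply/borel_funE; exact: LG.1.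
    apply: g0; have := negligible_reflect R d 0 _ mGN G0.
    by congr (_.-negligible _); rewrite predeqE => t /=; rewrite sub0r opprK.
  have := LLam _ Lz; rewrite LamE /= => -[m xE].
  apply: STFT_norm_reflect => //; first exact: L2Z (L2_modulated R d a n _ LG).
  move=> t; rewrite /modulated /modulated_reflect.
  have -> : fract_col R d a (x - t) = fract_col R d a (- t).
    by rewrite addrC xE fract_col_lattice.
  (* The two window factors trade places: [g (- (x - t)) = g (t - x)] and
     [g ((x - t) - x) = g (- t)]. *)
  rewrite opprB [x - t - x]addrC addrA [- x + x]addrC subrr sub0r; ring.
(* One open ray for each exponent: a cone, though not a convex one. *)
exists [set f | exists k n, 0 < k /\ f = (fun t => k * modulated R d a n G t)].
split; last split.
- move=> k k0 _ [k' [n [k'0 ->]]]; exists (k * k'), n; split; first exact: mulr_gt0.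
  by apply/funext => t; rewrite mulrA.
- apply: (infinite_dim_modulated R d a G _ a0 LG G0) => n.
  by exists 1, n; split=> //; apply/funext => t; rewrite mul1r.
- move=> _ [k [n [k0 ->]]]; split; first exact: L2Z (L2_modulated R d a n G LG).
  exists (fun t => k * modulated_reflect R d a n G t); split.
    exact: L2Z (L2_modulated_reflect R d a n G LG).
  split; first by apply: not_sim_modulated => //; exact: lt0r_neq0.
  exact: VG.
Qed.
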